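(* Let $q$ be a prime power. A unipotent conjugacy class of $\mathrm{PSL}(2,q)$ is minimal non-abelian (as a rack) if and only if $q$ is prime.
   Context: $\mathrm{PSL}(2,q)$ acts on the projective line $\mathbb{P}(1,q)$ over $\mathbb{F}_q$ by linear fractional transformations; a conjugacy class is unipotent if its elements have exactly one fixed point in $\mathbb{P}(1,q)$, i.e. it is the class of some $\begin{bmatrix}1&b\\0&1\end{bmatrix}$ with $b\in\mathbb{F}_q^\times$. A rack is a non-empty set $X$ with a binary operation $\triangleright$ such that every map $y\mapsto x\triangleright y$ is bijective and $x\triangleright(y\triangleright z)=(x\triangleright y)\triangleright(x\triangleright z)$. Conjugacy classes of a group are racks via $g\triangleright h=ghg^{-1}$. A subrack is a non-empty subset closed under $\triangleright$. A rack is abelian if $x\triangleright y=y$ for all $x,y$; it is minimal non-abelian if it is not abelian but all of its proper subracks are abelian. *)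

(* Defs.v *)
From mathcomp Require Import all_boot all_order all_algebra all_fingroup all_solvable.

Set Implicit Arguments.
Unset Strict Implicit.
Unset Printing Implicit Defensive.

Import GRing.Theory GroupScope.

Record rack := Rack {
  rack_sort :> Type;
  rack_op : rack_sort -> rack_sort -> rack_sort;
  rack_inhabited : inhabited rack_sort;
  rack_op_bij : forall x, bijective (rack_op x);
  rack_opD : forall x y z,
    rack_op x (rack_op y z) = rack_op (rack_op x y) (rack_op x z)
}.

Section SubRacks.

Variable X : rack.
Implicit Type Y : X -> Prop.

Definition abelian_rack := forall x y : X, rack_op x y = y.

Definition subrack Y :=
  (exists x, Y x) /\ (forall x y, Y x -> Y y -> Y (rack_op x y)).

Definition proper_subrack Y := subrack Y /\ (exists x, ~ Y x).

(* [Y] is abelian for the operation inherited from [X] *)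
Definition abelian_subrack Y := forall x y, Y x -> Y y -> rack_op x y = y.

Definition minimal_nonabelian :=
  ~ abelian_rack /\ (forall Y, proper_subrack Y -> abelian_subrack Y).

End SubRacks.

Arguments abelian_rack : clear implicits.
Arguments minimal_nonabelian : clear implicits.

Section ClassRack.

Variables (gT : finGroupType) (G : {group gT}) (C : {set gT}).
Hypothesis CG : C \in classes G.

(* [g |> h = g h g^-1], whereas the library's [h ^ g] is [g^-1 h g] *)
Fact class_rack_op_subproof (x y : {x | x \in C}) :
  val x * val y * (val x)^-1 \in C.
Proof.
case: x y => [x Cx] [y Cy] /=; case/imsetP: CG => a Ga defC.
have Gx : x \in G.
  by apply: subsetP Cx; rewrite defC class_subG.
move: Cy; rewrite defC => /imsetP[u Gu ->].
by rewrite -mulgA -{1}[x]invgK -conjgE -conjgM memJ_class ?groupM ?groupV.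
Qed.

Definition class_rack_op (x y : {x | x \in C}) : {x | x \in C} :=
  exist _ (val x * val y * (val x)^-1) (class_rack_op_subproof x y).

Fact class_rack_inhabited : inhabited {x | x \in C}.
Proof.
by case/imsetP: CG => a _ defC; split; exists a; rewrite defC class_refl.
Qed.

Fact class_rack_op_bij x : bijective (class_rack_op x).
Proof.
apply: injF_bij => y z /(congr1 val) /= /mulIg /mulgI; exact: val_inj.
Qed.

Fact class_rack_opD x y z :
  class_rack_op x (class_rack_op y z) =
  class_rack_op (class_rack_op x y) (class_rack_op x z).
Proof. by apply: val_inj; rewrite /= !invMg !invgK !mulgA !mulgKV. Qed.

Definition class_rack : rack :=
  Rack class_rack_inhabited class_rack_op_bij class_rack_opD.

End ClassRack.

Section PSL2.

Variable F : finFieldType.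

Definition SL2 : {set {'GL_2[F]}} := [set g | (\det (GLval g) == 1)%R].

Fact SL2_group_set : group_set SL2.
Proof.
apply/group_setP; split=> [|g h]; rewrite !inE ?GL_1E ?det1 //.
by rewrite GL_MxE det_mulmx => /eqP-> /eqP->; rewrite mulr1.
Qed.

Canonical SL2_group := Group SL2_group_set.

Definition PSL2 : {group coset_of 'Z(SL2)} := (SL2 / 'Z(SL2))%G.

(* Points of the projective line are [Some z] for [z : F] and the point at
   infinity [None]. *)
Definition proj_line : finType := option F.

(* z |-> (a z + b) / (c z + d) for A = [[a, b], [c, d]] *)
Definition linear_fractional (A : 'M[F]_2) (z : proj_line) : proj_line :=
  let a := A ord0 ord0 in let b := A ord0 ord_max in
  let c := A ord_max ord0 in let d := A ord_max ord_max in
  (if z is Some z then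
     if c * z + d == 0 then None else Some ((a * z + b) / (c * z + d))
   else if c == 0 then None else Some (a / c))%R.

(* The choice of representative of a coset is immaterial because the elements
   of ['Z(SL2)] are scalar matrices; see [PSL2_actE]. *)
Definition PSL2_act (u : coset_of 'Z(SL2)) (z : proj_line) : proj_line :=
  linear_fractional (GLval (repr u)) z.

Lemma SL2_center_scalar z : z \in 'Z(SL2) -> exists a, GLval z = (a%:M)%R.
Proof.
case/centerP=> _ cz.
have comm i j : i != j ->
    (GLval z *m delta_mx i j = delta_mx i j *m GLval z)%R.
  move=> neq_ij.
  have det1E : (\det (1%:M + delta_mx i j : 'M[F]_2) = 1)%R.
    rewrite (expand_det_row _ ord0) !big_ord_recl big_ord0 /cofactor.
    rewrite !det_mx11 !mxE.
    by case: i j neq_ij => [[|[|[]]] //= ?] [[|[|[]]] //= ?] _;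
      rewrite /= ?(addr0, add0r, mulr1, mul1r, mulr0, mul0r, expr0).
  have uE : (1%:M + delta_mx i j : 'M[F]_2)%R \in unitmx.
    by rewrite unitmxE det1E unitr1.
  have SE : (insubd (1 : {'GL_2[F]}) (1%:M + delta_mx i j)%R) \in SL2.
    by rewrite inE val_insubd uE det1E.
  have /(congr1 (@GLval 2 F)) := cz _ SE.
  rewrite !GL_MxE val_insubd uE mulmxDr mulmxDl mulmx1 mul1mx.
  exact: addrI.
have ent i j k l (e : i != j) := congr1 (fun A : 'M_2 => A k l) (comm i j e).
have := ent ord0 ord_max ord0 ord0 isT; have := ent ord_max ord0 ord0 ord0 isT.
have := ent ord0 ord_max ord0 ord_max isT.
rewrite !mxE !big_ord_recl !big_ord0 !mxE /=.
rewrite !(mulr1, mul1r, mulr0, mul0r, addr0, add0r).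
have -> : lift ord0 ord0 = ord_max :> 'I_2 by apply: val_inj.
move=> z00 z01 z10; exists (GLval z ord0 ord0); apply/matrixP=> i j.
have I2 (k : 'I_2) : k = ord0 \/ k = ord_max.
  by case: k => [[|[|[]]] // ?]; [left | right]; apply: val_inj.
by rewrite mxE; case: (I2 i) => ->; case: (I2 j) => ->;
  rewrite /= ?mulr1n ?mulr0n -?z10 -?z00 ?z01.
Qed.

Lemma PSL2_actE g z :
  g \in SL2 -> PSL2_act (coset 'Z(SL2) g) z = linear_fractional (GLval g) z.
Proof.
move=> Sg; have Ng : g \in 'N('Z(SL2)) by apply: subsetP Sg; apply: gFnorm.
rewrite /PSL2_act; have := mem_repr_coset (coset 'Z(SL2) g).
rewrite val_coset // => /rcosetP[c /SL2_center_scalar[a ca] ->].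
have a0 : (a != 0)%R.
  by have := GL_det c; rewrite ca det_scalar expf_eq0.
rewrite GL_MxE ca mul_scalar_mx /linear_fractional !mxE.
case: z => [z|]; last by rewrite mulf_eq0 (negPf a0) /= -mulf_div divff ?mul1r.
by rewrite -!mulrA -!mulrDr mulf_eq0 (negPf a0) /= -mulf_div divff ?mul1r.
Qed.

Definition unipotent (u : coset_of 'Z(SL2)) :=
  #|[set z | PSL2_act u z == z]| == 1%N.

Definition unipotent_class (C : {set coset_of 'Z(SL2)}) :=
  C \in classes PSL2 /\ {in C, forall u, unipotent u}.

End PSL2.

(* Main.v *)
Require Import Defs.
From mathcomp Require Import all_boot all_order all_algebra all_fingroup all_solvable
  all_field.
From mathcomp Require Import ring.

Set Implicit Arguments.
Unset Strict Implicit.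
Unset Printing Implicit Defensive.

Import GRing.Theory GroupScope.

(** Write U_b for the image in PSL(2,F) of the matrix with rows (1 b), (0 1),
    and L_t for that of the matrix with rows (1 0), (t 1).  In a unipotent
    class C every element fixes a point of the projective line, and the group
    is transitive on points, so every element of C is conjugate to some U_b in
    C with b <> 0 ([unipotent_class_transl]).

    C is never abelian.  If U_b is in C, so are its conjugates by the L_t; an
    element commuting with U_b has to fix the point at infinity, the only fixed
    point of U_b, and the conjugate by L_t moves that point when t <> 0
    ([conj_transl_noncommuting]).

    Let |F| be prime, and let x, y be non-commuting elements of C.  Conjugate
    x to U_b.  As F has no proper nonzero additive subgroup, the powers of U_b
    are all the U_t.  As y does not commute with x, its lower left entry is
    nonzero, so that multiplying it by translations on both sides gives an
    antidiagonal element, which conjugates the U_t to the L_t.  Together the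
    U_t and L_t generate PSL(2,F), so x and y do ([noncommuting_gen]).  A
    subrack containing x and y is stable under conjugation by the group they
    generate, hence contains a whole conjugacy class ([subrack_full]).
    A non-abelian subrack is therefore all of C.

    If |F| is not prime, let K be the prime subfield and U_b an element of C.
    The matrices of SL(2,F) that become K-rational after conjugation by
    diag(b,1) form a subgroup conjugate in GL(2,F) to SL(2,K).  Its intersection
    with C is a subrack containing U_b and its conjugate by L_(1/b), hence not
    abelian.  It is proper, because it misses the conjugates of U_b by L_t with
    b t outside K ([prime_form_conj_transl_inv]). *)

(** * Conjugacy classes as racks *)

Section ClassRackFacts.

Variables (gT : finGroupType) (G : {group gT}) (C : {set gT}).
Hypothesis CG : C \in classes G.

Lemma classes_sub : C \subset G.
Proof. by case/imsetP: CG => x Gx ->; apply: class_subG. Qed.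

Lemma classesJ x g : x \in C -> g \in G -> x ^ g \in C.
Proof. by case/imsetP: CG => y Gy -> /class_eqP <- Gg; apply: memJ_class. Qed.

Lemma class_rack_op_id (x y : class_rack CG) :
  (rack_op x y = y) <-> (val x * val y = val y * val x).
Proof.
split=> [/(congr1 val) /= xy | xy].
  by rewrite -[in RHS]xy mulgKV.
by apply: val_inj; rewrite /= xy mulgK.
Qed.

(** The elements whose conjugation action preserves a subrack [Y] of a finite
    rack form a subgroup containing [Y].  If two elements of [Y] generate the
    group, [Y] is thus stable under all conjugations, and these are transitive
    on the class. *)
Lemma subrack_full (Y : class_rack CG -> Prop) (x y : class_rack CG) :
    subrack Y -> Y x -> Y y -> G \subset <<[set val x; val y]>> ->
  forall z, Y z.
Proof.
move=> [_ YM] Yx Yy genG z.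
(* [Y] being a mere [Prop], its stabiliser is a predicate rather than a set. *)
pose stabY (g : gT) := g \in G /\ forall s t : class_rack CG,
  Y s -> val t = g * val s * g^-1 -> Y t.
have stabP s : Y s -> stabY (val s).
  move=> Ys; split; first exact: subsetP classes_sub _ (valP s).
  move=> t t' Yt Et'; have <- : rack_op s t = t' by apply: val_inj.
  exact: YM.
have [w Gw defC] := imsetP CG.
have [h Gh zE] : exists2 h, h \in G & val z = h * val x * h^-1.
  have : val z \in w ^: G by rewrite -defC; apply: valP.
  have /class_eqP <- : val x \in w ^: G by rewrite -defC; apply: valP.
  case/imsetP=> h Gh ->; exists h^-1; rewrite ?groupV //.
  by rewrite invgK conjgE mulgA.
suffices [_ ] : stabY h by apply; first exact: Yx.
have /gen_prodgP[n [c Hc ->]] := subsetP genG _ Gh.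
elim/big_ind: _ => [|g1 g2 [G1 S1] [G2 S2]|i _].
- split=> // s t Ys; rewrite mul1g invg1 mulg1 => /val_inj -> //.
- split=> [|s t Ys]; first exact: groupM.
  rewrite invMg -!mulgA (mulgA (val s)) (mulgA g2) => Et.
  have Cs : g2 * (val s * g2^-1) \in C.
    have := classesJ (valP s) (groupVr G2).
    by rewrite conjgE invgK.
  pose g2s : class_rack CG := exist (fun r => r \in C) _ Cs.
  apply: (S1 g2s) => //; last by rewrite Et /= -!mulgA.
  by apply: (S2 s) => //=; rewrite mulgA.
by have := Hc i; rewrite !inE => /orP[] /eqP ->; apply: stabP.
Qed.

End ClassRackFacts.

(** * Two by two matrices in coordinates *)

Section ProjectiveMatrices.

Variable F : finFieldType.
Implicit Types (a b c d e t : F) (g : {'GL_2[F]}) (w : coset_of 'Z(SL2 F)).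

Definition mx2 a b c d : 'M[F]_2 :=
  \matrix_(i, j) if i == ord0 then if j == ord0 then a else b
                 else if j == ord0 then c else d.

Arguments mx2 (a b c d)%_R.

(** The determinant as a polynomial, so that [ring] and [field] see it. *)
Definition det2 a b c d := (a * d - b * c)%R.

Arguments det2 (a b c d)%_R.

Lemma ord2P (i : 'I_2) : i = ord0 \/ i = ord_max.
Proof. by case: i => [[|[|[]]] // ?]; [left | right]; apply: val_inj. Qed.

Lemma lift0_ord2 : lift ord0 ord0 = ord_max :> 'I_2.
Proof. exact: val_inj. Qed.

Lemma mx2E (M : 'M[F]_2) :
  M = mx2 (M ord0 ord0) (M ord0 ord_max) (M ord_max ord0) (M ord_max ord_max).
Proof.
apply/matrixP=> i j; rewrite mxE.
by case: (ord2P i) => ->; case: (ord2P j) => ->.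
Qed.

Lemma det_mx2 a b c d : (\det (mx2 a b c d))%R = det2 a b c d.
Proof.
rewrite (expand_det_row _ ord0) !big_ord_recl big_ord0 /cofactor !det_mx11.
by rewrite !mxE /= /det2; ring.
Qed.

Lemma mulmx2 a b c d a' b' c' d' :
  (mx2 a b c d *m mx2 a' b' c' d' =
   mx2 (a * a' + b * c') (a * b' + b * d')
       (c * a' + d * c') (c * b' + d * d'))%R.
Proof.
apply/matrixP=> i j; rewrite !mxE !big_ord_recl big_ord0 lift0_ord2 !mxE addr0.
by case: (ord2P i) => ->; case: (ord2P j) => ->.
Qed.

Definition sl2 a b c d : {'GL_2[F]} :=
  insubd (1 : {'GL_2[F]}) (mx2 a b c d).

Arguments sl2 (a b c d)%_R.

Lemma GLval_inj : injective (@GLval 2 F).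
Proof. exact: val_inj. Qed.

Lemma GLval_sl2 a b c d :
  det2 a b c d = 1%R -> GLval (sl2 a b c d) = mx2 a b c d.
Proof.
by move=> D1; rewrite /sl2 val_insubd unitmxE det_mx2 D1 unitr1.
Qed.

Lemma mem_sl2 a b c d : det2 a b c d = 1%R -> sl2 a b c d \in SL2 F.
Proof. by move=> D1; rewrite inE GLval_sl2 // det_mx2 D1. Qed.

Lemma SL2P g : g \in SL2 F ->
  exists a b c d, det2 a b c d = 1%R /\ g = sl2 a b c d.
Proof.
rewrite inE [GLval g]mx2E det_mx2 => /eqP D1; do 4!eexists; split; first exact: D1.
by apply: GLval_inj; rewrite GLval_sl2 // -mx2E.
Qed.

Lemma det2M a b c d a' b' c' d' :
  det2 a b c d = 1%R -> det2 a' b' c' d' = 1%R ->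
  det2 (a * a' + b * c') (a * b' + b * d')
       (c * a' + d * c') (c * b' + d * d') = 1%R.
Proof. by rewrite -!det_mx2 -mulmx2 det_mulmx => -> ->; rewrite mulr1. Qed.

Lemma sl2M a b c d a' b' c' d' :
  det2 a b c d = 1%R -> det2 a' b' c' d' = 1%R ->
  sl2 a b c d * sl2 a' b' c' d' =
  sl2 (a * a' + b * c') (a * b' + b * d')
      (c * a' + d * c') (c * b' + d * d').
Proof.
move=> D1 D1'; apply: GLval_inj; rewrite GL_MxE !GLval_sl2 ?mulmx2 //.
exact: det2M.
Qed.

Lemma mx2_inj a b c d a' b' c' d' :
  mx2 a b c d = mx2 a' b' c' d' -> [/\ a = a', b = b', c = c' & d = d'].
Proof.
move/matrixP=> E; split; [have := E ord0 ord0 | have := E ord0 ord_max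
  | have := E ord_max ord0 | have := E ord_max ord_max]; by rewrite !mxE.
Qed.

Lemma SL2_scalarP g : g \in 'Z(SL2 F) ->
  exists2 e, (e * e = 1)%R & g = sl2 e 0%R 0%R e.
Proof.
move=> Zg; have [e ge] := SL2_center_scalar Zg.
have: g \in SL2 F by apply: subsetP Zg; apply: center_sub.
have ge2: GLval g = mx2 e 0%R 0%R e by rewrite ge [LHS]mx2E !mxE.
rewrite inE ge2 det_mx2 => /eqP D1; exists e; first by rewrite -D1 /det2; ring.
by apply: GLval_inj; rewrite GLval_sl2.
Qed.

Lemma mem_center_scalar e : (e * e = 1)%R -> sl2 e 0%R 0%R e \in 'Z(SL2 F).
Proof.
move=> e1; have D1: det2 e 0 0 e = 1%R by rewrite /det2 e1; ring.
apply/centerP; split; first exact: mem_sl2.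
move=> _ /SL2P[a [b [c [d [D ->]]]]].
by rewrite /commute !sl2M //; congr sl2; ring.
Qed.

Definition psl a b c d := coset 'Z(SL2 F) (sl2 a b c d).

Arguments psl (a b c d)%_R.

Lemma SL2_norm g : g \in SL2 F -> g \in 'N('Z(SL2 F)).
Proof. by move=> Sg; apply: subsetP Sg; apply: gFnorm. Qed.

Lemma mem_psl a b c d : det2 a b c d = 1%R -> psl a b c d \in PSL2 F.
Proof. by move=> D; rewrite mem_quotient ?mem_sl2. Qed.

Lemma pslP w : w \in PSL2 F ->
  exists a b c d, det2 a b c d = 1%R /\ w = psl a b c d.
Proof.
by case/morphimP=> g _ /SL2P[a [b [c [d [D ->]]]]] ->; exists a, b, c, d.
Qed.

Lemma pslM a b c d a' b' c' d' :
  det2 a b c d = 1%R -> det2 a' b' c' d' = 1%R ->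
  psl a b c d * psl a' b' c' d' =
  psl (a * a' + b * c') (a * b' + b * d')
      (c * a' + d * c') (c * b' + d * d').
Proof.
by move=> D D'; rewrite /psl -sl2M // morphM //; apply/SL2_norm/mem_sl2.
Qed.

Lemma psl1 : psl 1 0 0 1 = 1.
Proof.
by apply: coset_id; apply: mem_center_scalar; rewrite mulr1.
Qed.

Lemma pslV a b c d :
  det2 a b c d = 1%R -> (psl a b c d)^-1 = psl d (- b) (- c) a.
Proof.
move=> D; have D': det2 d (- b) (- c) a = 1%R by rewrite -D /det2; ring.
apply/eqP; rewrite eq_invg_mul pslM // -psl1; apply/eqP.
by congr psl; rewrite -?D /det2; ring.
Qed.

(** The kernel of SL(2,F) -> PSL(2,F) consists of scalars of square 1. *)
Lemma psl_eq a b c d a' b' c' d' :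
    det2 a b c d = 1%R -> det2 a' b' c' d' = 1%R ->
    psl a b c d = psl a' b' c' d' ->
  exists2 e, (e * e = 1)%R &
    [/\ a = e * a', b = e * b', c = e * c' & d = e * d']%R.
Proof.
move=> D D' /esym eq_w.
have /rcosetP[z] : sl2 a b c d \in 'Z(SL2 F) :* sl2 a' b' c' d'.
  rewrite -val_coset ?SL2_norm ?mem_sl2 // -/(psl _ _ _ _) eq_w.
  by rewrite val_coset ?SL2_norm ?mem_sl2 // rcoset_refl.
case/SL2_scalarP=> e e1 -> eq_sl; exists e => //; move: eq_sl.
have De: det2 e 0 0 e = 1%R by rewrite /det2 e1; ring.
move/(congr1 (@GLval 2 F)); rewrite GL_MxE !GLval_sl2 // mulmx2.
by case/mx2_inj=> -> -> -> ->; split; ring.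
Qed.

Lemma psl_scale e a b c d : (e * e = 1)%R -> det2 a b c d = 1%R ->
  psl (e * a) (e * b) (e * c) (e * d) = psl a b c d.
Proof.
move=> e1 D; have De: det2 e 0 0 e = 1%R by rewrite /det2 e1; ring.
have ->: psl (e * a) (e * b) (e * c) (e * d) = psl e 0 0 e * psl a b c d.
  by rewrite pslM //; congr psl; ring.
by rewrite {1}/psl coset_id ?mul1g ?mem_center_scalar.
Qed.

Lemma psl_act a b c d z : det2 a b c d = 1%R ->
  PSL2_act (psl a b c d) z =
  (if z is Some z then
     if c * z + d == 0 then None else Some ((a * z + b) / (c * z + d))
   else if c == 0 then None else Some (a / c))%R.
Proof.
by move=> D; rewrite PSL2_actE ?mem_sl2 // GLval_sl2 // /linear_fractional !mxE.
Qed.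

(** * Translations and unipotent elements *)

(** The linear fractional transformation z |-> z + b. *)
Definition transl b : coset_of 'Z(SL2 F) := psl 1 b 0 1.

Arguments transl b%_R.

Lemma det2_transl b : det2 1 b 0 1 = 1%R.
Proof. by rewrite /det2; ring. Qed.

Lemma translD b b' : transl b * transl b' = transl (b + b')%R.
Proof. by rewrite /transl pslM ?det2_transl //; congr psl; ring. Qed.

Lemma transl_expg b n : transl b ^+ n = transl (b *+ n)%R.
Proof.
elim: n => [|n IHn]; first by rewrite expg0 mulr0n /transl psl1.
by rewrite expgS IHn translD mulrS.
Qed.

(** An element commuting with a nontrivial translation fixes the only fixed
    point of the translation, which is the point at infinity. *)
Lemma commute_transl b a c d e :
  b != 0%R -> det2 a e c d = 1%R ->
  transl b * psl a e c d = psl a e c d * transl b -> c = 0%R.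
Proof.
move=> b0 D; rewrite /transl !pslM ?det2_transl //.
case/psl_eq; rewrite ?det2M ?det2_transl // => r _ [_ _].
rewrite !mulr1 !mulr0 !addr0 !mul0r !add0r !mul1r => ec ed.
have [//|c0] := eqVneq c 0%R.
have r1: r = 1%R by apply: (mulIf c0); rewrite -ec mul1r.
move/eqP: ed; rewrite r1 mul1r -subr_eq0 opprD addrCA subrr addr0 oppr_eq0.
by rewrite mulf_eq0 (negPf b0) orbF => /eqP.
Qed.

Lemma unipotentP w :
  reflect (exists z, forall z', (PSL2_act w z' == z') = (z' == z)) (unipotent w).
Proof.
apply: (iffP cards1P) => [] [z Dz]; exists z.
  by move=> z'; have /setP/(_ z') := Dz; rewrite !inE.
by apply/setP=> z'; rewrite !inE Dz.
Qed.

(** The eigenvalues [a] and [d] must agree: otherwise [b / (d - a)] would be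
    fixed besides the point at infinity. *)
Lemma unipotent_upper a b d :
  det2 a b 0 d = 1%R -> unipotent (psl a b 0 d) ->
  exists2 b', b' != 0%R & psl a b 0 d = transl b'.
Proof.
move=> D /unipotentP[z Dz].
have zE: z = None.
  by apply/esym/eqP; rewrite -Dz psl_act // eqxx.
have D1: (a * d = 1)%R by rewrite -D /det2; ring.
have d0: d != 0%R by apply: contra_eq_neq D1 => ->; rewrite mulr0 eq_sym oner_eq0.
have Dx x : (a * x + b != x * d)%R.
  have:= Dz (Some x); rewrite zE psl_act // mul0r add0r (negPf d0).
  by move/negbT; apply: contraNneq => ->; rewrite mulfK.
have ad: a = d.
  apply/eqP; rewrite -subr_eq0; apply: contraT => ad0.
  by case/eqP: (Dx (- b / (a - d))%R); field; rewrite ad0.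
subst d; exists (a * b)%R.
  by rewrite mulf_neq0 //; move: (Dx 0%R); rewrite mulr0 mul0r add0r.
have ->: psl a b 0 a = psl (a * 1) (a * (a * b)) (a * 0) (a * 1).
  by congr psl; rewrite ?mulrA ?D1; ring.
by apply: psl_scale; rewrite ?det2_transl.
Qed.

(** Conjugating by an element that sends the point at infinity to a fixed point
    of [w] makes [w] upper triangular; the conjugate is still in the class, so
    it is again unipotent. *)
Lemma unipotent_class_transl (C : {set coset_of 'Z(SL2 F)}) w :
  unipotent_class C -> w \in C ->
  exists2 h, h \in PSL2 F & exists2 b, b != 0%R & w ^ h = transl b.
Proof.
move=> uC Cw.
have [a [b [c [d [D wE]]]]] :=
  pslP (subsetP (classes_sub uC.1) _ Cw).
have [z fixz]: exists z, PSL2_act w z == z.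
  by have /unipotentP[z Dz] := uC.2 _ Cw; exists z; rewrite Dz.
suffices [h Gh [a' [b' [d' [D' whE]]]]]: exists2 h, h \in PSL2 F &
    exists a' b' d', det2 a' b' 0 d' = 1%R /\ w ^ h = psl a' b' 0 d'.
  exists h => //; rewrite whE; apply: unipotent_upper => //.
  by rewrite -whE; apply/uC.2/(classesJ uC.1).
move: fixz; rewrite wE psl_act //; case: z => [x|]; last first.
  case: (c =P 0%R) => // c0 _; exists 1; first exact: group1.
  by rewrite conjg1; exists a, b, d; rewrite -c0.
case: ifP => // /negbT cxd /eqP[E].
have fixx: (a * x + b = x * (c * x + d))%R.
  by apply: (canRL (mulfVK cxd) E).
(* This matrix sends the point at infinity to [x]. *)
have Dg: det2 x (- 1) 1 0 = 1%R by rewrite /det2; ring.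
exists (psl x (- 1) 1 0); first exact: mem_psl.
exists (c * x + d)%R, (- c)%R, (a - c * x)%R.
have D0: det2 (c * x + d) (- c) 0 (a - c * x) = 1%R.
  rewrite -D /det2; move/eqP: fixx; rewrite -subr_eq0 => /eqP fixx.
  transitivity (a * d - b * c + c * (a * x + b - x * (c * x + d)))%R; first by ring.
  by rewrite fixx; ring.
have DV: det2 0 1 (- 1) x = 1%R by rewrite /det2; ring.
split => //; rewrite conjgE pslV // opprK !pslM ?det2M //.
congr psl; try ring.
by rewrite mulN1r !mulr1 fixx; ring.
Qed.

(** * Generation by non-commuting unipotent elements *)

Definition lower_transl t : coset_of 'Z(SL2 F) := psl 1 0 t 1.

Arguments lower_transl t%_R.

Lemma det2_lower_transl t : det2 1 0 t 1 = 1%R.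
Proof. by rewrite /det2; ring. Qed.

Lemma transl_lowerE a b c d : c != 0%R -> det2 a b c d = 1%R ->
  psl a b c d =
  transl ((a - 1) / c)%R * lower_transl c * transl ((d - 1) / c)%R.
Proof.
move=> c0 D; rewrite /transl /lower_transl.
rewrite !pslM ?det2M ?det2_transl ?det2_lower_transl //.
have bc: (b = (a * d - 1) / c)%R.
  by rewrite -D /det2; field.
by rewrite bc; congr psl; field.
Qed.

Lemma PSL2_sub_transl (H : {group coset_of 'Z(SL2 F)}) :
    (forall t, transl t \in H) -> (forall t, lower_transl t \in H) ->
  PSL2 F \subset H.
Proof.
move=> HU HL; apply/subsetP=> w /pslP[a [b [c [d [D ->]]]]].
have offdiag a' b' c' d' :
    det2 a' b' c' d' = 1%R -> c' != 0%R -> psl a' b' c' d' \in H.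
  by move=> D' c0; rewrite transl_lowerE // !groupM.
have [c0|] := eqVneq c 0%R; last exact: offdiag.
have a0: a != 0%R.
  apply: contra_eq_neq D => ->; rewrite c0 /det2 mulr0 mul0r subrr.
  by rewrite eq_sym oner_neq0.
(* Multiplying by [lower_transl 1] adds the first row to the second, which
   reduces the case [c = 0] to the other one. *)
rewrite -(groupMl _ (HL 1%R)) /lower_transl pslM ?det2_lower_transl //.
apply: offdiag; first by rewrite det2M ?det2_lower_transl.
by rewrite c0 mul1r mulr0 addr0.
Qed.

Lemma prime_field_mulrn b t :
  prime #|F| -> b != 0%R -> exists n, t = (b *+ n)%R.
Proof.
move=> prF b0; suffices /cycleP[n ->]: t \in <[b]> by exists n.
apply: subsetP (in_setT t); apply: prime_meetG; first by rewrite cardsT.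
by rewrite setTI cycle_eq1.
Qed.

(** The powers of [transl b] are all the translations.  Clearing the diagonal of
    the second generator with translations leaves an antidiagonal element,
    which swaps the points 0 and infinity and hence conjugates translations to
    lower ones. *)
Lemma PSL2_sub_gen b a e c d :
    prime #|F| -> b != 0%R -> c != 0%R -> det2 a e c d = 1%R ->
  PSL2 F \subset <<[set transl b; psl a e c d]>>.
Proof.
move=> prF b0 c0 D; pose H := <<[set transl b; psl a e c d]>>%G.
rewrite -/(gval H).
have HU t : transl t \in H.
  have [n ->] := prime_field_mulrn t prF b0; rewrite -transl_expg groupX //.
  by rewrite mem_gen // !inE eqxx.
have HM : psl a e c d \in H by rewrite mem_gen // !inE eqxx orbT.
have Dw: det2 0 (- c^-1) c 0 = 1%R by rewrite /det2; field.
have Hw : psl 0 (- c^-1) c 0 \in H.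
  have ->: psl 0 (- c^-1) c 0
           = transl (- (a / c))%R * psl a e c d * transl (- (d / c))%R.
    rewrite /transl !pslM ?det2M ?det2_transl //.
    have ec: (e = (a * d - 1) / c)%R by rewrite -D /det2; field.
    by rewrite ec; congr psl; field.
  by rewrite !groupM.
apply: (PSL2_sub_transl HU) => t.
have ->: lower_transl t = transl (- (t / (c * c)))%R ^ (psl 0 (- c^-1) c 0)^-1.
  have DV: det2 0 (c^-1) (- c) 0 = 1%R by rewrite /det2; field.
  rewrite conjgE invgK pslV // opprK /transl !pslM ?det2M ?det2_transl //.
  by congr psl; field.
by rewrite groupJ ?groupV.
Qed.

(** Up to conjugation [x] is a translation; if [y] had zero lower left entry, it
    would be a translation too and commute with [x]. *)
Lemma noncommuting_gen (C : {set coset_of 'Z(SL2 F)}) x y :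
    prime #|F| -> unipotent_class C -> x \in C -> y \in C -> x * y != y * x ->
  PSL2 F \subset <<[set x; y]>>.
Proof.
move=> prF uC Cx Cy nxy.
have [h Gh [b b0 xhE]] := unipotent_class_transl uC Cx.
have [a [e [c [d [D yhE]]]]] : exists a e c d,
    det2 a e c d = 1%R /\ y ^ h = psl a e c d.
  by apply/pslP; rewrite groupJ // (subsetP (classes_sub uC.1)).
have c0: c != 0%R.
  apply: contraNneq nxy => c0; rewrite -(inj_eq (conjg_inj h)) !conjMg.
  rewrite c0 in D yhE.
  have [b' _ E] : exists2 b', b' != 0%R & y ^ h = transl b'.
    rewrite yhE; apply: unipotent_upper; rewrite -?yhE //.
    by apply: uC.2; apply: (classesJ uC.1).
  by rewrite xhE E !translD addrC.
rewrite -(conjSg _ _ h) -genJ conjUg !conjg_set1 xhE yhE conjGid //.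
exact: PSL2_sub_gen.
Qed.

(** * Conjugates of a translation *)

(** The conjugates of [transl b] by lower triangular unipotents, parametrised by
    the upper left entry [a]; they all have upper right entry [b]. *)
Definition conj_transl b a : coset_of 'Z(SL2 F) :=
  transl b ^ (lower_transl ((1 - a) / b))^-1.

Arguments conj_transl (b a)%_R.

Lemma conj_translE b a : b != 0%R ->
  conj_transl b a = psl a b (- ((1 - a) ^+ 2 / b)) (2%:R - a).
Proof.
move=> b0; rewrite /conj_transl conjgE invgK /lower_transl /transl.
rewrite pslV ?det2_lower_transl // oppr0.
rewrite !pslM ?det2M ?det2_transl ?det2_lower_transl //.
by congr psl; field.
Qed.

Lemma det2_conj_transl b a : b != 0%R ->
  det2 a b (- ((1 - a) ^+ 2 / b)) (2%:R - a) = 1%R.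
Proof. by move=> b0; rewrite /det2; field. Qed.

Lemma conj_transl_noncommuting b a : b != 0%R -> a != 1%R ->
  transl b * conj_transl b a != conj_transl b a * transl b.
Proof.
move=> b0 a1; apply/eqP; rewrite conj_translE // => /commute_transl.
move=> /(_ b0 (det2_conj_transl _ b0)) /eqP.
by rewrite oppr_eq0 mulf_eq0 expf_eq0 invr_eq0 subr_eq0 (negPf b0) eq_sym (negPf a1).
Qed.

Lemma unipotent_class_conj_transl (C : {set coset_of 'Z(SL2 F)}) :
    unipotent_class C ->
  exists2 b, b != 0%R & transl b \in C /\ forall a, conj_transl b a \in C.
Proof.
move=> uC; have [x Cx] : exists x, x \in C.
  by case/imsetP: uC.1 => x _ ->; exists x; apply: class_refl.
have [h Gh [b b0 xhE]] := unipotent_class_transl uC Cx.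
have Cb : transl b \in C by rewrite -xhE (classesJ uC.1).
exists b => //; split=> // a; apply: (classesJ uC.1) => //.
by rewrite groupV; apply/mem_psl/det2_lower_transl.
Qed.

(** * The subrack defined over the prime field *)

(** In a finite field the prime field is the set of multiples of 1, which are
    visibly closed under addition and multiplication. *)
Definition in_prime_field t := exists n : nat, t = (n%:R)%R.

Lemma in_prime_fieldD a b :
  in_prime_field a -> in_prime_field b -> in_prime_field (a + b)%R.
Proof. by case=> m -> [n ->]; exists (m + n)%N; rewrite natrD. Qed.

Lemma in_prime_fieldM a b :
  in_prime_field a -> in_prime_field b -> in_prime_field (a * b)%R.
Proof. by case=> m -> [n ->]; exists (m * n)%N; rewrite natrM. Qed.

(** Conjugating by diag(b,1) divides the upper right entry by [b] and multiplies
    the lower left one by [b]; these are the elements that become rational over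
    the prime field, in particular [transl b]. *)
Definition prime_form b w := exists a e c d,
  [/\ det2 a e c d = 1%R, w = psl a e c d,
      in_prime_field a /\ in_prime_field d
    & in_prime_field (e / b)%R /\ in_prime_field (c * b)%R].

Lemma prime_formM b w w' : b != 0%R ->
  prime_form b w -> prime_form b w' -> prime_form b (w * w').
Proof.
move=> b0 [a [e [c [d [D -> [pa pd] [pe pc]]]]]].
case=> [a' [e' [c' [d' [D' -> [pa' pd'] [pe' pc']]]]]].
rewrite pslM //; do 4!eexists; split; [exact: (det2M D D') | by [] | split | split].
- have ->: (a * a' + e * c' = a * a' + (e / b) * (c' * b))%R by field.
  by apply: in_prime_fieldD; apply: in_prime_fieldM.
- have ->: (c * e' + d * d' = (c * b) * (e' / b) + d * d')%R by field.
  by apply: in_prime_fieldD; apply: in_prime_fieldM.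
- have ->: ((a * e' + e * d') / b = a * (e' / b) + (e / b) * d')%R by field.
  by apply: in_prime_fieldD; apply: in_prime_fieldM.
have ->: ((c * a' + d * c') * b = (c * b) * a' + d * (c' * b))%R by ring.
by apply: in_prime_fieldD; apply: in_prime_fieldM.
Qed.

(** Inverses are powers, the group being finite. *)
Lemma prime_formV b w : b != 0%R -> prime_form b w -> prime_form b w^-1.
Proof.
move=> b0 pw; rewrite invg_expg; elim: (#[w].-1) => [|n IHn]; last first.
  by rewrite expgS; apply: prime_formM.
rewrite expg0 -psl1; exists 1%R, 0%R, 0%R, 1%R; split; rewrite ?det2_transl //.
  by split; exists 1%N.
by split; exists 0%N; rewrite mul0r.
Qed.

Lemma prime_form_transl b : b != 0%R -> prime_form b (transl b).
Proof.
move=> b0; exists 1%R, b, 0%R, 1%R; split; rewrite ?det2_transl //.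
  by split; exists 1%N.
by split; [exists 1%N; rewrite divff | exists 0%N; rewrite mul0r].
Qed.

Lemma prime_form_conj_transl0 b : b != 0%R -> prime_form b (conj_transl b 0).
Proof.
move=> b0; have pL: prime_form b (lower_transl ((1 - 0) / b)%R).
  exists 1%R, 0%R, ((1 - 0) / b)%R, 1%R; split; rewrite ?det2_lower_transl //.
    by split; exists 1%N.
  by split; [exists 0%N; rewrite mul0r | exists 1%N; rewrite subr0 divfK].
rewrite /conj_transl conjgE invgK.
apply: prime_formM => //; apply: prime_formM; last exact: prime_formV.
  by [].
exact: prime_form_transl.
Qed.

(** Two matrices of the same element differ by a scalar of square 1, which has to
    lie in the prime field as both upper right entries are in [b] times that
    field; hence so does [a]. *)
Lemma prime_form_conj_transl_inv b a :
  b != 0%R -> prime_form b (conj_transl b a) -> in_prime_field a.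
Proof.
move=> b0 [a' [e [c [d [D E [pa' _] [pe _]]]]]]; move: E.
rewrite conj_translE // => /psl_eq[| |r r1 [-> be _ _]] //.
  exact: det2_conj_transl.
apply: in_prime_fieldM => //.
have rn: (r * (e / b) = 1)%R by rewrite mulrA -be divff.
by have <-: (e / b = r)%R by rewrite -[LHS]mul1r -r1 -mulrA rn mulr1.
Qed.

Lemma prime_field_proper p k :
  #|F| = (p ^ k)%N -> prime p -> (1 < k)%N -> exists a, ~ in_prime_field a.
Proof.
move=> Fq prp k1; have chp := card_finPcharP Fq prp.
have [a Da | sFp] := pickP [pred a : F | [forall n : 'I_p, a != n%:R%R]].
  exists a => -[n an]; have := forallP Da (Ordinal (ltn_pmod n (prime_gt0 prp))).
  by rewrite /= (GRing.natr_mod_pchar chp) an eqxx.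
have: (#|F| <= #|'I_p|)%N.
  apply: leq_trans (leq_image_card (fun n : 'I_p => n%:R%R : F) predT).
  apply/subset_leq_card/subsetP=> a _; have /negbT := sFp a.
  by rewrite negb_forall => /existsP[n /negPn/eqP ->]; apply: image_f.
by rewrite card_ord Fq -{2}(expn1 p) leq_exp2l ?prime_gt1 // leqNgt k1.
Qed.

End ProjectiveMatrices.

(** * Minimality *)

Theorem corollary5p14 (q : nat)
    (hq : exists p k : nat, [/\ prime p, (0 < k)%N & q = (p ^ k)%N])
    (F : finFieldType) (hF : #|F| = q)
    (C : {set coset_of 'Z(SL2 F)}) (hC : unipotent_class C) :
  minimal_nonabelian (class_rack (proj1 hC)) <-> prime q.
Proof.
set CG := proj1 hC.
have [b b0 [Cu Cv]] := unipotent_class_conj_transl hC.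
pose u : class_rack CG := exist (fun r => r \in C) _ Cu.
pose v a : class_rack CG := exist (fun r => r \in C) _ (Cv a).
have uv a : a != 1%R -> rack_op u (v a) <> v a.
  by move=> a1 /class_rack_op_id /eqP; apply/negP/conj_transl_noncommuting.
have n01: (0 != 1 :> F)%R by rewrite eq_sym oner_neq0.
split=> [[_ minC] | prq].
  have [p [k [prp k0 qE]]] := hq; have [k1|k1] := leqP k 1.
    by rewrite qE (_ : k = 1%N) ?expn1 //; apply/eqP; rewrite eqn_leq k1.
  have [a na] := prime_field_proper (etrans hF qE) prp k1.
  pose Y (x : class_rack CG) := prime_form b (val x).
  case: (uv _ n01); apply: (minC Y); last exact: prime_form_conj_transl0.
    split; last by exists (v a) => /(prime_form_conj_transl_inv b0).
    split; first by exists u; apply: prime_form_transl.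
    by move=> x y Yx Yy; do !apply: prime_formM => //; apply: prime_formV.
  exact: prime_form_transl.
split=> [abC|Y [sY [z nYz]] x y Yx Yy]; first exact: (uv _ n01).
apply/class_rack_op_id/eqP; apply: contra_notT nYz => nxy.
apply: (subrack_full sY Yx Yy).
by apply: (noncommuting_gen _ hC) nxy; rewrite ?hF //; apply: valP.
Qed.
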